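(* Let $g:\mathcal{X}\to\mathcal{Z}$ be a one-to-one map of the experimental region $\mathcal{X}$ onto the experimental region $\mathcal{Z}$, and let $\tilde g:\mathcal{B}\to\tilde{\mathcal{B}}$ be an accompanying transformation of the parameter vector. Let $\Phi$ be a criterion function on the designs on $\mathcal{X}$ and $\Phi'$ (which may depend on $g$ and $\tilde g$) a criterion function on the designs on $\mathcal{Z}$, and assume that the pair $\Phi,\Phi'$ is equivariant with respect to $(g,\tilde g)$. If $\xi^*$ is a $\Phi$-optimal design on $\mathcal{X}$, then its image $(\xi^* )^g$ is a $\Phi'$-optimal design on $\mathcal{Z}$.
   Context: A design $\xi$ on a set $\mathcal{X}$ is given by finitely many mutually distinct support points $\mathbf{x}_1,\dots,\mathbf{x}_m\in\mathcal{X}$ with weights $w_1,\dots,w_m>0$, $\sum_i w_i=1$ (i.e. a finitely supported probability measure on $\mathcal{X}$). For a one-to-one map $g$ of $\mathcal{X}$ onto $\mathcal{Z}$, the image $\xi^g$ is the design on $\mathcal{Z}$ with support points $g(\mathbf{x}_i)$ and weights $w_i$. A criterion function is a convex function on designs with values in $\mathbb{R}\cup\{\infty\}$; a design $\xi^*$ is $\Phi$-optimal if $\Phi(\xi^* )\le\Phi(\xi)$ for all designs $\xi$ on the same region. The pair of criteria $\Phi$ (for designs on $\mathcal{X}$) and $\Phi'$ (for designs on $\mathcal{Z}$) is called equivariant with respect to $(g,\tilde g)$ if for any two designs $\xi_1,\xi_2$ on $\mathcal{X}$ the relation $\Phi(\xi_1)\le\Phi(\xi_2)$ implies $\Phi'(\xi_1^g)\le\Phi'(\xi_2^g)$.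 The transformation $\tilde g$ enters only through the possible dependence of $\Phi'$ on it. *)

(* Defs.v *)
From HB Require Import structures.
From mathcomp Require Import all_boot all_order all_algebra finmap.
From mathcomp Require Import all_classical all_reals interval_inference.
From mathcomp Require Import ereal convex.

Set Implicit Arguments.
Unset Strict Implicit.
Unset Printing Implicit Defensive.

Import Order.TTheory GRing.Theory Num.Theory.
Local Open Scope fset_scope.
Local Open Scope ring_scope.
Local Open Scope convex_scope.

(* A design is encoded by its weight function, which vanishes off the support:
   the mutually distinct support points are the elements of [finsupp w].
   Designs with the same support points and weights are thus equal, whatever
   the order in which the points are listed. *)
Definition is_design (R : realType) (X : choiceType)
    (w : {fsfun X -> R with 0}) : bool :=
  all (fun x => 0 < w x) (finsupp w) && (\sum_(x <- finsupp w) w x == 1).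

Record design (R : realType) (X : choiceType) : Type := Design {
  weight :> {fsfun X -> R with 0};
  weightP : is_design weight }.

HB.instance Definition _ (R : realType) (X : choiceType) :=
  [isSub for @weight R X].
HB.instance Definition _ (R : realType) (X : choiceType) :=
  [Choice of design R X by <:].

Section DesignTheory.
Context {R : realType}.

Lemma designP (X : choiceType) (xi1 xi2 : design R X) :
  (forall x, xi1 x = xi2 x) -> xi1 = xi2.
Proof. by move=> /fsfunP/val_inj. Qed.

Lemma design_ge0 (X : choiceType) (xi : design R X) x : 0 <= xi x.
Proof.
have /andP[/allP w0 _] := weightP xi.
by have [|/w0/ltW//] := finsuppP xi x; rewrite lexx.
Qed.

Lemma sum_finsuppW (X : choiceType) (w : {fsfun X -> R with 0})
    (B : {fset X}) :
  finsupp w `<=` B -> \sum_(x <- B) w x = \sum_(x <- finsupp w) w x.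
Proof.
by move=> sB; apply/esym/big_fset_incl => // x _ /fsfun_dflt.
Qed.

Lemma design_sum1 (X : choiceType) (xi : design R X) (B : {fset X}) :
  finsupp xi `<=` B -> \sum_(x <- B) xi x = 1.
Proof. by move=> /sum_finsuppW ->; have /andP[_ /eqP] := weightP xi. Qed.

Lemma is_designP (X : choiceType) (w : {fsfun X -> R with 0}) (B : {fset X}) :
  (forall x, 0 <= w x) -> finsupp w `<=` B -> \sum_(x <- B) w x = 1 ->
  is_design w.
Proof.
move=> w0 sB sw; rewrite /is_design -(sum_finsuppW sB) sw eqxx andbT.
by apply/allP => x; rewrite mem_finsupp lt_def w0 => ->.
Qed.

Section Mixture.
Context {X : choiceType}.
Implicit Types (t : {i01 R}) (xi : design R X).

Definition mix_weight t xi1 xi2 : {fsfun X -> R with 0} :=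
  [fsfun x in finsupp xi1 `|` finsupp xi2 =>
     t%:num * xi1 x + (1 - t%:num) * xi2 x].

Lemma mix_weightE t xi1 xi2 x :
  mix_weight t xi1 xi2 x = t%:num * xi1 x + (1 - t%:num) * xi2 x.
Proof.
rewrite fsfunE; case: ifPn => //; rewrite in_fsetU negb_or => /andP[x1 x2].
by rewrite (fsfun_dflt x1) (fsfun_dflt x2) !mulr0 addr0.
Qed.

Lemma mix_weightP t xi1 xi2 : is_design (mix_weight t xi1 xi2).
Proof.
apply: (@is_designP _ _ (finsupp xi1 `|` finsupp xi2)).
- move=> x; rewrite mix_weightE.
  by apply: addr_ge0; apply: mulr_ge0; rewrite ?design_ge0// subr_ge0 le1.
- exact: finsupp_sub.
- under eq_bigr do rewrite mix_weightE.
  rewrite big_split /= -!mulr_sumr !design_sum1 ?fsubsetUl ?fsubsetUr//.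
  by rewrite !mulr1 addrC subrK.
Qed.

Definition mix t xi1 xi2 : design R X := Design (mix_weightP t xi1 xi2).

Lemma mixE t xi1 xi2 x :
  mix t xi1 xi2 x = t%:num * xi1 x + (1 - t%:num) * xi2 x.
Proof. exact: mix_weightE. Qed.

Lemma mix1 xi1 xi2 : mix 1%:i01 xi1 xi2 = xi1.
Proof. by apply: designP => x; rewrite mixE subrr mul1r mul0r addr0. Qed.

Lemma mixmm t xi : mix t xi xi = xi.
Proof. by apply: designP => x; rewrite mixE -mulrDl addrC subrK mul1r. Qed.

Lemma mixC t xi1 xi2 : mix t xi1 xi2 = mix (1 - t%:num)%:i01 xi2 xi1.
Proof. by apply: designP => x; rewrite !mixE/= subKr addrC. Qed.

Lemma mixA : convex_quasi_associative mix.
Proof.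
move=> p q r s a b c prs spq; apply: designP => x.
rewrite !mixE mulrDr addrA [in RHS]mulrDr.
congr (_ + _ + _); rewrite mulrA.
- by rewrite prs (mulrC r%:num).
- by rewrite (ConvexQuasiAssoc.pq_sr prs spq) mulrA.
- by rewrite -spq.
Qed.

HB.instance Definition _ :=
  isConvexSpace.Build R (design R X) mix1 mixmm mixC mixA.

End Mixture.

Section Image.
Context {X Z : choiceType}.
Variables (g : X -> Z) (xi : design R X).

Definition image_weight : {fsfun Z -> R with 0} :=
  [fsfun z in g @` finsupp xi => \sum_(x <- finsupp xi | g x == z) xi x].

Lemma image_weightP : is_design image_weight.
Proof.
apply: (@is_designP _ _ (g @` finsupp xi)).
- move=> z; rewrite fsfunE; case: ifP => // _.
  by apply: sumr_ge0 => x _; exact: design_ge0.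
- exact: finsupp_sub.
- rewrite big_seq; under eq_bigr => z zB do rewrite fsfunE zB.
  rewrite -big_seq (exchange_big_dep predT)//=.
  rewrite -(design_sum1 (fsubset_refl (finsupp xi))).
  rewrite [LHS]big_seq [RHS]big_seq; apply: eq_bigr => x xS.
  rewrite big_mkcond (bigD1_seq (g x)) ?in_imfset//= eqxx.
  by rewrite big1 ?addr0// => z; rewrite eq_sym => /negPf ->.
Qed.

(* For an arbitrary map [g] this is the push-forward, merging support points
   with the same image; for a one-to-one [g] it has support points [g x] with
   the unchanged weights, see [finsupp_image] and [design_imageE]. *)
Definition design_image : design R Z := Design image_weightP.

Hypothesis g_inj : injective g.

Lemma design_imageE x : design_image (g x) = xi x.
Proof.
rewrite /= fsfunE; have [xS|xS] := finsuppP xi x.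
  case: imfsetP => //= -[y yS /g_inj xy].
  by rewrite xy yS in xS.
rewrite in_imfset//= big_mkcond (bigD1_seq x) ?fset_uniq//= eqxx.
by rewrite big1 ?addr0// => y; rewrite (inj_eq g_inj) => /negPf ->.
Qed.

Lemma finsupp_image : finsupp design_image = g @` finsupp xi.
Proof.
apply/eqP; rewrite eqEfsubset finsupp_sub /=.
apply/fsubsetP => _ /imfsetP[x /= xS ->].
by rewrite mem_finsupp design_imageE -mem_finsupp.
Qed.

End Image.
End DesignTheory.

Section Criteria.
Context {R : realType}.
Local Open Scope ereal_scope.

(* Values lie in R together with +oo.  The convention 0 * +oo = 0 of [\bar R]
   makes the convexity inequality trivial at t = 0 and t = 1. *)
Definition criterion (X : choiceType) (Phi : design R X -> \bar R) : Prop :=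
  (forall xi, Phi xi != -oo) /\
  (forall (t : {i01 R}) (xi1 xi2 : design R X),
     Phi (xi1 <| t |> xi2)
       <= (t%:num)%:E * Phi xi1 + (1 - t%:num)%:E * Phi xi2).

Definition optimal (X : choiceType) (Phi : design R X -> \bar R)
    (xi : design R X) : Prop :=
  forall xi', Phi xi <= Phi xi'.

(* [Phi'] is a family of criteria indexed by the pair of transformations, of
   which only the member at [(g, gt)] is involved. *)
Definition equivariant (X Z : choiceType) (B B' : Type)
    (g : X -> Z) (gt : B -> B') (Phi : design R X -> \bar R)
    (Phi' : (X -> Z) -> (B -> B') -> design R Z -> \bar R) : Prop :=
  forall xi1 xi2 : design R X, Phi xi1 <= Phi xi2 ->
    Phi' g gt (design_image g xi1) <= Phi' g gt (design_image g xi2).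

End Criteria.

(* Main.v *)
Require Import Defs.
From mathcomp Require Import all_boot all_order all_algebra.
From mathcomp Require Import all_classical all_reals ereal.

(** Since [g] is invertible, every competitor on [Z] is the image of a design on [X], namely its own
    image under the inverse ([design_imageK]). Equivariance then carries each inequality that
    expresses optimality on [X] over to [Z]. *)

Lemma design_imageK {R : realType} {X Z : choiceType} {g : X -> Z} {h : Z -> X} :
  cancel g h -> cancel h g ->
  cancel (@design_image R Z X h) (@design_image R X Z g).
Proof.
move=> gK hK xi; apply: designP => z.
(* [design_imageE] reads weights only at image points, so [z] is first written as [g (h z)]. *)
by rewrite -{1}(hK z) (design_imageE _ (can_inj gK)) (design_imageE _ (can_inj hK)).
Qed.

Theorem theorem1 (R : realType) (X Z : choiceType) (B B' : Type)
    (g : X -> Z) (g_bij : bijective g) (gt : B -> B')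
    (Phi : design R X -> \bar R)
    (Phi' : (X -> Z) -> (B -> B') -> design R Z -> \bar R)
    (Phi_crit : criterion Phi) (Phi'_crit : criterion (Phi' g gt))
    (Phi_equiv : equivariant g gt Phi Phi')
    (xi : design R X) (xi_opt : optimal Phi xi) :
  optimal (Phi' g gt) (design_image g xi).
Proof.
case: g_bij => h gK hK xi'.
(* On [X], [xi] is compared with the pulled-back competitor [design_image h xi']. *)
by rewrite -(design_imageK gK hK xi'); apply/Phi_equiv/xi_opt.
Qed.
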